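(* Let $(V,m)$ be an $n$-ary totally associative algebra (resp. $n$-ary partially associative algebra) and let $\rho: V\to V$ be an endomorphism of the $n$-ary totally associative (resp. $n$-ary partially associative) algebra $(V,m)$. Set $m_\rho=\rho\circ m$ and $\widetilde{\rho}=(\rho,\dots,\rho)$ ($n-1$ copies of $\rho$). Then $(V,m_\rho,\widetilde{\rho})$ is an $n$-ary totally Hom-associative algebra (resp. $n$-ary partially Hom-associative algebra). Moreover, suppose that $(V',m')$ is another $n$-ary totally associative algebra (resp. $n$-ary partially associative algebra) and $\rho': V'\to V'$ is an endomorphism of the $n$-ary totally associative (resp. $n$-ary partially associative) algebra $(V',m')$. If $f:V\to V'$ is a morphism of $n$-ary totally associative algebras (resp. $n$-ary partially associative algebras) from $(V,m)$ to $(V',m')$ that satisfies $f\circ\rho=\rho'\circ f$, then $$f:(V,m_\rho,\widetilde{\rho})\longrightarrow (V',m'_{\rho'},\widetilde{\rho'})$$ is a morphism of $n$-ary totally Hom-associative algebras (resp. $n$-ary partially Hom-associative algebras), where $m'_{\rho'}=\rho'\circ m'$ and $\widetilde{\rho'}=(\rho',\dots,\rho')$ ($n-1$ copies).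
   Context: Throughout, $\mathbb{K}$ is an algebraically closed field of characteristic zero, all vector spaces are over $\mathbb{K}$, and $n$ is a positive integer. Consider triples $(V,m,\alpha)$ consisting of a vector space $V$, an $n$-linear map $m:V^{\times n}\to V$ and a family $\alpha=(\alpha_i)_{i=1,\dots,n-1}$ of linear maps $\alpha_i:V\to V$. For $0\le i\le n-1$ and $x_1,\dots,x_{2n-1}\in V$ put $$T_i(x_1,\dots,x_{2n-1})=m(\alpha_1(x_1),\dots,\alpha_i(x_i),m(x_{i+1},\dots,x_{i+n}),\alpha_{i+1}(x_{i+1+n}),\dots,\alpha_{n-1}(x_{2n-1})).$$ The triple $(V,m,\alpha)$ is an $n$-ary totally Hom-associative algebra if $T_0=T_1=\dots=T_{n-1}$ on $V^{2n-1}$. It is an $n$-ary partially Hom-associative algebra if $\sum_{i=0}^{n-1}T_i=0$ on $V^{2n-1}$. The (classical) $n$-ary totally associative and $n$-ary partially associative algebras $(V,m)$ are the cases of these definitions in which all $\alpha_i$ are the identity map of $V$. A morphism $(V,m)\to(V',m')$ of such classical algebras is a linear map $f:V\to V'$ with $f(m(x_1,\dots,x_n))=m'(f(x_1),\dots,f(x_n))$ for all $x_1,\dots,x_n\in V$; an endomorphism is a morphism from $(V,m)$ to itself. A morphism of $n$-ary totally (resp. partially) Hom-associative algebras $(V,m,\alpha)\to(V',m',\alpha')$ is a linear map $f:V\to V'$ such that $f(m(x_1,\dots,x_n))=m'(f(x_1),\dots,f(x_n))$ for all $x_1,\dots,x_n\in V$ and $f\circ\alpha_i=\alpha'_i\circ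 f$ for all $i=1,\dots,n-1$. *)

(* Defs.v *)
From HB Require Import structures.
From mathcomp Require Import all_boot all_algebra.

Set Implicit Arguments.
Unset Strict Implicit.
Unset Printing Implicit Defensive.

Import GRing.Theory.
Local Open Scope ring_scope.

Definition tuple_set (T : Type) (n : nat) (x : n.-tuple T) (i : 'I_n) (u : T) :
    n.-tuple T :=
  [tuple if k == i then u else tnth x k | k < n].

Definition multilinear (K : fieldType) (V W : lmodType K) (n : nat)
    (m : n.-tuple V -> W) : Prop :=
  forall (i : 'I_n) (x : n.-tuple V), linear (fun u : V => m (tuple_set x i u)).

(* All indices start at 0: [alpha l] is the mathematicians' alpha_{l+1} and
   [x`_k] is x_{k+1}.  The outer [m] has the inner product in position [i]; its
   other positions are [lift i l], for l < n - 1, which hold [alpha l] applied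
   to [x`_l] when left of [i] and to [x`_(l + n)] when right of it.  Every index in
   [x`_k] is smaller than 2n - 1, so the default value 0 is never used. *)
Definition hom_assoc_term (K : fieldType) (V : lmodType K) (n : nat)
    (m : n.-tuple V -> V) (alpha : 'I_n.-1 -> {linear V -> V}) (i : 'I_n)
    (x : (2 * n - 1).-tuple V) : V :=
  m [tuple if unlift i j is Some l
           then alpha l x`_(if (l < i)%N then val l else (l + n)%N)
           else m [tuple x`_(i + k)%N | k < n]
    | j < n].

Definition totally_hom_associative (K : fieldType) (V : lmodType K) (n : nat)
    (m : n.-tuple V -> V) (alpha : 'I_n.-1 -> {linear V -> V}) : Prop :=
  multilinear m /\
  forall (i j : 'I_n) (x : (2 * n - 1).-tuple V),
    hom_assoc_term m alpha i x = hom_assoc_term m alpha j x.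

Definition partially_hom_associative (K : fieldType) (V : lmodType K) (n : nat)
    (m : n.-tuple V -> V) (alpha : 'I_n.-1 -> {linear V -> V}) : Prop :=
  multilinear m /\
  forall x : (2 * n - 1).-tuple V, \sum_(i < n) hom_assoc_term m alpha i x = 0.

Definition const_family (K : fieldType) (V : lmodType K) (n : nat)
    (rho : {linear V -> V}) : 'I_n.-1 -> {linear V -> V} :=
  fun _ => rho.
Arguments const_family {K V} n rho _.

Definition totally_associative (K : fieldType) (V : lmodType K) (n : nat)
    (m : n.-tuple V -> V) : Prop :=
  totally_hom_associative m (const_family n (idfun : {linear V -> V})).

Definition partially_associative (K : fieldType) (V : lmodType K) (n : nat)
    (m : n.-tuple V -> V) : Prop :=
  partially_hom_associative m (const_family n (idfun : {linear V -> V})).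

Definition algebra_morphism (K : fieldType) (V V' : lmodType K) (n : nat)
    (m : n.-tuple V -> V) (m' : n.-tuple V' -> V') (f : {linear V -> V'}) : Prop :=
  forall x : n.-tuple V, f (m x) = m' (map_tuple f x).

Definition hom_algebra_morphism (K : fieldType) (V V' : lmodType K) (n : nat)
    (m : n.-tuple V -> V) (alpha : 'I_n.-1 -> {linear V -> V})
    (m' : n.-tuple V' -> V') (alpha' : 'I_n.-1 -> {linear V' -> V'})
    (f : {linear V -> V'}) : Prop :=
  algebra_morphism m m' f /\
  forall l : 'I_n.-1, f \o alpha l =1 alpha' l \o f.

(* Main.v *)
Require Import Defs.
From HB Require Import structures.
From mathcomp Require Import all_boot all_algebra.

(** The twist works because [rho] is an endomorphism of [m].  In a term of the
    Hom-associativity condition for [rho \o m], every argument of the outer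
    [m] carries exactly one [rho]: the side arguments receive it from the
    twisting family, the inner product from [rho \o m].  Since [rho] commutes
    with [m], it comes out of the outer [m], where it meets the [rho] of the
    outer product; so the term is the image under [rho \o rho] of the
    corresponding term for the untwisted [m] ([hom_assoc_term_twist]).  Being
    linear, [rho \o rho] preserves both the equality of all these terms and
    the vanishing of their sum.  A morphism [f] that intertwines [rho]
    and [rho'] passes through both factors of the twisted product:
    [f (rho (m x)) = rho' (f (m x)) = rho' (m' (f x))], where [f] applies to
    [x] entrywise. *)

Set Implicit Arguments.
Unset Strict Implicit.
Unset Printing Implicit Defensive.

Import GRing.Theory.
Local Open Scope ring_scope.

Lemma multilinear_comp (K : fieldType) (V W W' : lmodType K) (n : nat)
    (m : n.-tuple V -> W) (g : {linear W -> W'}) :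
  multilinear m -> multilinear (g \o m).
Proof. by move=> m_lin i x a u v /=; rewrite m_lin linearP. Qed.

(** One [rho] is the outer factor of the twisted product; the other is the
    one shared by all arguments of the outer [m], pulled out of it. *)
Lemma hom_assoc_term_twist (K : fieldType) (V : lmodType K) (n : nat)
    (m : n.-tuple V -> V) (rho : {linear V -> V}) (i : 'I_n)
    (x : (2 * n - 1).-tuple V) :
  algebra_morphism m m rho ->
  hom_assoc_term (rho \o m) (const_family n rho) i x =
  rho (rho (hom_assoc_term m (const_family n (idfun : {linear V -> V})) i x)).
Proof.
move=> rho_morph; rewrite /hom_assoc_term /=; congr (rho _).
rewrite [RHS]rho_morph; congr m.
by apply: eq_from_tnth => j; rewrite tnth_mktuple [RHS]tnth_map tnth_mktuple; case: unlift.
Qed.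

Lemma totally_hom_associative_twist (K : fieldType) (V : lmodType K) (n : nat)
    (m : n.-tuple V -> V) (rho : {linear V -> V}) :
  totally_associative m -> algebra_morphism m m rho ->
  totally_hom_associative (rho \o m) (const_family n rho).
Proof.
move=> [m_lin m_assoc] rho_morph; split; first exact: multilinear_comp.
by move=> i j x; rewrite !hom_assoc_term_twist // (m_assoc i j).
Qed.

Lemma partially_hom_associative_twist (K : fieldType) (V : lmodType K) (n : nat)
    (m : n.-tuple V -> V) (rho : {linear V -> V}) :
  partially_associative m -> algebra_morphism m m rho ->
  partially_hom_associative (rho \o m) (const_family n rho).
Proof.
move=> [m_lin m_assoc] rho_morph; split; first exact: multilinear_comp.
move=> x; under eq_bigr do rewrite hom_assoc_term_twist //.
by rewrite -!linear_sum m_assoc !linear0.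
Qed.

Lemma hom_algebra_morphism_twist (K : fieldType) (V V' : lmodType K) (n : nat)
    (m : n.-tuple V -> V) (rho : {linear V -> V})
    (m' : n.-tuple V' -> V') (rho' : {linear V' -> V'})
    (f : {linear V -> V'}) :
  algebra_morphism m m' f -> f \o rho =1 rho' \o f ->
  hom_algebra_morphism (rho \o m) (const_family n rho)
    (rho' \o m') (const_family n rho') f.
Proof.
move=> f_morph f_rho; split=> [x|l]; last exact: f_rho.
by have /= -> := f_rho (m x); rewrite f_morph.
Qed.

Theorem theorem2p6 (K : closedFieldType) (K_char0 : [pchar K] =i pred0)
    (n : nat) (n_gt0 : (0 < n)%N)
    (V : lmodType K) (m : n.-tuple V -> V) (rho : {linear V -> V}) :
  (totally_associative m -> algebra_morphism m m rho ->
     totally_hom_associative (rho \o m) (const_family n rho) /\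
     forall (V' : lmodType K) (m' : n.-tuple V' -> V')
         (rho' : {linear V' -> V'}) (f : {linear V -> V'}),
       totally_associative m' -> algebra_morphism m' m' rho' ->
       algebra_morphism m m' f -> f \o rho =1 rho' \o f ->
       totally_hom_associative (rho' \o m') (const_family n rho') /\
       hom_algebra_morphism (rho \o m) (const_family n rho)
         (rho' \o m') (const_family n rho') f)
  /\
  (partially_associative m -> algebra_morphism m m rho ->
     partially_hom_associative (rho \o m) (const_family n rho) /\
     forall (V' : lmodType K) (m' : n.-tuple V' -> V')
         (rho' : {linear V' -> V'}) (f : {linear V -> V'}),
       partially_associative m' -> algebra_morphism m' m' rho' ->
       algebra_morphism m m' f -> f \o rho =1 rho' \o f ->
       partially_hom_associative (rho' \o m') (const_family n rho') /\
       hom_algebra_morphism (rho \o m) (const_family n rho)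
         (rho' \o m') (const_family n rho') f).
Proof.
split=> m_assoc rho_morph; split.
- exact: totally_hom_associative_twist.
- move=> V' m' rho' f m'_assoc rho'_morph f_morph f_rho.
  by split; [exact: totally_hom_associative_twist
            |exact: hom_algebra_morphism_twist].
- exact: partially_hom_associative_twist.
- move=> V' m' rho' f m'_assoc rho'_morph f_morph f_rho.
  by split; [exact: partially_hom_associative_twist
            |exact: hom_algebra_morphism_twist].
Qed.
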